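(* Let $G=(V,E)$ be an undirected graph with $|V|=n$ and $|E|=m$, and let $s,t\in V$ be two vertices with $st\in E$. (a) There exists an ILP with $O(n(n+m))$ variables and $O(n(n+m))$ constraints that computes an optimum $st$-orientation of $G$. (b) Alternatively, there exists an ILP formulation with $O(k(n+m))$ variables and $O(k(n+m))$ constraints that has a solution if and only if a height-$k$ $st$-orientation of $G$ exists. (c) Likewise, there exists a SAT formulation with $O(k(n+m))$ variables and $O(k^2(n+m))$ clauses of maximum size $n$ that has a solution if and only if a height-$k$ $st$-orientation of $G$ exists.
   Context: An $st$-orientation of $G$ is an orientation of the edges of $G$ such that $s$ is the unique source and $t$ is the unique sink. An optimum $st$-orientation is an $st$-orientation for which the length of the longest directed path from $s$ to $t$ is minimum. For an integer $k$, a height-$k$ $st$-orientation is an $st$-orientation such that the longest path has length at most $k$. An ILP formulation is an integer linear program associated with the input (here $G,s,t$, and $k$ where applicable); having a solution means that it is feasible. A SAT formulation is a set of Boolean clauses associated with the input; its solutions are the satisfying assignments. The size of a clause is its number of literals. *)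

(* Defs.v *)
From HB Require Import structures.
From mathcomp Require Import all_boot all_order all_algebra.

Set Implicit Arguments.
Unset Strict Implicit.
Unset Printing Implicit Defensive.

Import Order.TTheory GRing.Theory Num.Theory.

Record sgraph (V : finType) := SGraph {
  adj : rel V;
  adj_sym : symmetric adj;
  adj_irrefl : irreflexive adj }.

Definition edges (V : finType) (G : sgraph V) : {set {set V}} :=
  [set [set p.1; p.2] | p : V * V & adj G p.1 p.2].

Section Orientations.
Variables (V : finType) (G : sgraph V).
Implicit Types (d : rel V) (s t v : V).

(* [d u v] means that the edge uv is directed from u to v. *)
Definition orientation d : Prop :=
  (forall u v, d u v -> adj G u v) /\
  (forall u v, adj G u v -> d u v (+) d v u).

Definition acyclic d : Prop := forall c : seq V, cycle d c -> c = [::].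

Definition source d v : bool := [forall u, ~~ d u v].
Definition sink d v : bool := [forall u, ~~ d v u].

(* Acyclicity is part of the notion of st-orientation (also known as bipolar
   orientation): a unique source and a unique sink do not imply it. *)
Definition st_orientation s t d : Prop :=
  [/\ orientation d, acyclic d,
      forall v, source d v = (v == s)
    & forall v, sink d v = (v == t)].

Definition dpath d v (p : seq V) : bool := path d v p && uniq (v :: p).

(* Lengths count edges, so all of them are smaller than [#|V|]. *)
Definition longest_path d : nat :=
  \max_(l < #|V| | [exists v, [exists p : l.-tuple V, dpath d v p]]) l.

Definition longest_path_between s t d : nat :=
  \max_(l < #|V| | [exists p : l.-tuple V, dpath d s p && (last s p == t)]) l.

Definition optimum_st_orientation s t d : Prop :=
  st_orientation s t d /\
  forall d', st_orientation s t d' ->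
    longest_path_between s t d <= longest_path_between s t d'.

Definition height_st_orientation (k : nat) s t d : Prop :=
  st_orientation s t d /\ longest_path d <= k.

End Orientations.

(* minimize [ilp_obj *m x] subject to [ilp_mx *m x <= ilp_rhs], x integral *)
Record ilp := ILP {
  ilp_nvars : nat;
  ilp_ncons : nat;
  ilp_mx : 'M[int]_(ilp_ncons, ilp_nvars);
  ilp_rhs : 'cV[int]_ilp_ncons;
  ilp_obj : 'rV[int]_ilp_nvars }.

Definition ilp_feasible (P : ilp) (x : 'cV[int]_(ilp_nvars P)) : Prop :=
  forall i, ((ilp_mx P *m x)%R i ord0 <= ilp_rhs P i ord0)%R.
Arguments ilp_feasible P x : clear implicits.

Definition ilp_value (P : ilp) (x : 'cV[int]_(ilp_nvars P)) : int :=
  (ilp_obj P *m x)%R ord0 ord0.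
Arguments ilp_value P x : clear implicits.

Definition ilp_optimal (P : ilp) (x : 'cV[int]_(ilp_nvars P)) : Prop :=
  ilp_feasible P x /\
  forall y, ilp_feasible P y -> (ilp_value P x <= ilp_value P y)%R.
Arguments ilp_optimal P x : clear implicits.

(* The literal [(i, b)] is the variable i if b = true, its negation otherwise. *)
Definition literal (N : nat) : Type := ('I_N * bool)%type.
Definition clause (N : nat) : Type := seq (literal N).
Record sat := SAT {
  sat_nvars : nat;
  sat_clauses : seq (clause sat_nvars) }.

Definition satisfies (F : sat) (a : {ffun 'I_(sat_nvars F) -> bool}) : bool :=
  all (fun c : clause _ => has (fun l : literal _ => a l.1 == l.2) c)
      (sat_clauses F).
Arguments satisfies F a : clear implicits.

(* Among the variables of a formulation, [arc u v] (for each edge uv) is the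
   one with value 1, resp. true, if and only if uv is directed from u to v; the
   values of [arc] on non-adjacent pairs are irrelevant. *)
Definition ilp_reads (V : finType) (G : sgraph V) (P : ilp)
    (arc : V -> V -> 'I_(ilp_nvars P)) (x : 'cV[int]_(ilp_nvars P))
    (d : rel V) : Prop :=
  forall u v, adj G u v -> x (arc u v) ord0 = Posz (d u v).

Definition sat_reads (V : finType) (G : sgraph V) (F : sat)
    (arc : V -> V -> 'I_(sat_nvars F)) (a : {ffun 'I_(sat_nvars F) -> bool})
    (d : rel V) : Prop :=
  forall u v, adj G u v -> a (arc u v) = d u v.

(* The solutions [sol], read off through [reads], are exactly the orientations
   in [S].  The mere equivalence between solvability and the existence of an
   orientation would be met by an instance-dependent choice between a trivially
   solvable and a trivially unsolvable formulation. *)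
Definition encodes (V : finType) (X : Type) (reads : X -> rel V -> Prop)
    (sol : X -> Prop) (S : rel V -> Prop) : Prop :=
  (forall x, sol x -> exists2 d, S d & reads x d) /\
  (forall d, S d -> exists2 x, sol x & reads x d).

(* Main.v *)
(** An orientation is acyclic of height at most k exactly when the vertices carry
    heights in {0, .., k} that increase along every arc: the length of a longest
    path ending at a vertex is such a labelling, and any labelling bounds the
    length of all paths.  Heights and arc directions are the variables of both
    formulations: integer heights with a big-M constraint per arc for the ILP
    (the height of t is then the objective), the unary encoding of heights for
    SAT. *)
Require Import Defs.
From mathcomp Require Import all_boot all_order all_algebra.
From mathcomp Require Import zify.

Set Implicit Arguments.
Unset Strict Implicit.
Unset Printing Implicit Defensive.

Import Order.TTheory GRing.Theory Num.Theory.

(** * Labellings that increase along arcs *)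

Section Rank.
Variables (V : finType) (d : rel V) (h : V -> nat).
Hypothesis h_mono : forall u v, d u v -> h u < h v.

Lemma rank_path x p : path d x p -> h x + size p <= h (last x p).
Proof.
elim: p x => [|y p IHp] x /=; first by rewrite addn0.
by case/andP=> /h_mono lt_xy /IHp; lia.
Qed.

Lemma rank_acyclic : acyclic d.
Proof.
case=> // x p /= /rank_path; rewrite last_rcons size_rcons; lia.
Qed.

Lemma rank_longest_path k : (forall v, h v <= k) -> longest_path d <= k.
Proof.
move=> h_le; apply/bigmax_leqP => l /existsP[v /existsP[p /andP[/rank_path]]].
by rewrite size_tuple => le_h _; have := h_le (last v p); lia.
Qed.

Lemma rank_longest_path_between s t : longest_path_between s t d <= h t.
Proof.
apply/bigmax_leqP => l /existsP[p /andP[/andP[/rank_path le_h _] /eqP <-]].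
by move: le_h; rewrite size_tuple; lia.
Qed.

End Rank.

(** * Length of a longest path ending at a vertex *)

Section Height.
Variables (V : finType) (d : rel V).

Definition height v : nat :=
  \max_(l < #|V| | [exists u, [exists p : l.-tuple V,
                      dpath d u p && (last u p == v)]]) l.

Lemma dpath_size u p : dpath d u p -> size p < #|V|.
Proof.
by case/andP=> _ /card_uniqP E; rewrite -[_.+1]/(size (u :: p)) -E; apply: max_card.
Qed.

Lemma dpath_longest u p : dpath d u p -> size p <= longest_path d.
Proof.
move=> dp; have lt_p := dpath_size dp.
rewrite -[size p]/(val (Ordinal lt_p)); apply: leq_bigmax_cond.
by apply/existsP; exists u; apply/existsP; exists (in_tuple p).
Qed.

Lemma dpath_longest_between s p :
  dpath d s p -> size p <= longest_path_between s (last s p) d.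
Proof.
move=> dp; have lt_p := dpath_size dp.
rewrite -[X in X <= _]/(val (Ordinal lt_p)); apply: leq_bigmax_cond.
by apply/existsP; exists (in_tuple p); rewrite dp eqxx.
Qed.

Lemma dpath_height u p : dpath d u p -> size p <= height (last u p).
Proof.
move=> dp; have lt_p := dpath_size dp.
rewrite -[X in X <= _]/(val (Ordinal lt_p)); apply: leq_bigmax_cond.
by apply/existsP; exists u; apply/existsP; exists (in_tuple p); rewrite dp eqxx.
Qed.

(** The maximum is attained because the empty path at [v] makes its index set nonempty. *)
Lemma height_dpath v :
  exists u p, [/\ dpath d u p, last u p = v & size p = height v].
Proof.
pose A := [pred l : 'I_#|V| | [exists u, [exists p : l.-tuple V,
             dpath d u p && (last u p == v)]]].
have A_gt0 : 0 < #|A|.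
  have V_gt0 : 0 < #|V| by apply/card_gt0P; exists v.
  apply/card_gt0P; exists (Ordinal V_gt0); rewrite inE.
  by apply/existsP; exists v; apply/existsP; exists [tuple]; rewrite /dpath /= eqxx.
have [l /existsP[u /existsP[p /andP[dp /eqP pv]]] hl] :=
  eq_bigmax_cond (fun l : 'I_#|V| => val l) A_gt0.
by exists u, p; split=> //; rewrite size_tuple -hl.
Qed.

Lemma height_ltn v : height v < #|V|.
Proof. by have [u [p [/dpath_size lt_p _ <-]]] := height_dpath v. Qed.

Lemma height_le_longest v : height v <= longest_path d.
Proof. by have [u [p [/dpath_longest le_p _ <-]]] := height_dpath v. Qed.

Lemma height_source v : source d v -> height v = 0.
Proof.
move/forallP=> v_src; have [u [p []]] := height_dpath v.
case/lastP: p => [|p x] //; rewrite last_rcons => /andP[+ _] xv.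
by rewrite rcons_path xv (negPf (v_src _)) andbF.
Qed.

Hypothesis d_acyc : acyclic d.

(** The part of a walk between two visits to the same vertex would be a directed cycle, so every
    walk is simple. *)
Lemma acyclic_dpath x p : path d x p -> dpath d x p.
Proof.
rewrite /dpath => d_p; rewrite d_p /=.
elim: p x d_p => [|y p IHp] x // /[dup] d_xp /= /andP[_ /IHp /= ->].
rewrite andbT; apply/negP => x_p; case/splitPr: x_p d_xp => p1 p2.
by rewrite -cat_rcons cat_path => /andP[/(@d_acyc (x :: p1))].
Qed.

(** Appending [v] to a longest path ending at [u] gives a walk, which is simple by acyclicity. *)
Lemma height_arc u v : d u v -> height u < height v.
Proof.
move=> d_uv; have [w [p [/andP[d_p _] pu <-]]] := height_dpath u.
have /acyclic_dpath/dpath_height : path d w (rcons p v).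
  by rewrite rcons_path d_p pu.
by rewrite size_rcons last_rcons.
Qed.

(* A longest path ending in [t] starts at a source, else it could be extended. *)
Lemma height_longest_between s t :
  (forall v, source d v = (v == s)) -> height t = longest_path_between s t d.
Proof.
move=> src; apply/eqP; rewrite eqn_leq.
rewrite (rank_longest_path_between height_arc) andbT.
have [u [p [dp pt hp]]] := height_dpath t.
have u_s : u = s.
  apply/eqP; rewrite -src; apply/forallP => w; apply/negP => d_wu.
  have /acyclic_dpath/dpath_height : path d w (u :: p).
    by rewrite /= d_wu; case/andP: dp.
  by rewrite /= pt -hp ltnn.
by rewrite -hp -pt u_s; apply: dpath_longest_between; rewrite -u_s.
Qed.

End Height.

(** * Ordered arcs, and variables indexed by them *)

Section Arcs.
Variables (V : finType) (G : sgraph V).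

Definition arcs : {set V * V} := [set p | adj G p.1 p.2].

(** Counting by fibres: an edge is the unordered image of at most two pairs, one the swap of the
    other. *)
Lemma card_arcs : #|arcs| <= 2 * #|edges G|.
Proof.
pose f (p : V * V) := [set p.1; p.2].
have -> : edges G = f @: arcs.
  by apply/setP => e; apply/imsetP/imsetP => -[p Gp ->]; exists p; rewrite ?inE // in Gp *.
rewrite -sum1_card (partition_big_imset f) /= mulnC -sum_nat_const.
apply: leq_sum => _ /imsetP[q _ ->]; rewrite sum1dep_card.
apply: (@leq_trans #|[set q; (q.2, q.1)]|); last by rewrite cards2; case: (_ != _).
apply/subset_leq_card/subsetP => -[a b]; case: q => x y; rewrite !inE /f /=.
case/andP=> _ /eqP e_ab.
have: (a \in [set x; y]) && (b \in [set x; y]) by rewrite -e_ab !inE !eqxx orbT.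
have: (x \in [set a; b]) && (y \in [set a; b]) by rewrite e_ab !inE !eqxx orbT.
rewrite !inE !xpair_eqE; do !case: eqVneq => ? //=; subst; by rewrite ?eqxx.
Qed.

Definition arc_type : finType := {p : V * V | adj G p.1 p.2}.

Lemma card_arc_type : #|arc_type| = #|arcs|.
Proof. by rewrite card_sig; apply: eq_card => p; rewrite !inE. Qed.

(** The default [inl b0] only makes the function total: solutions are read on adjacent pairs
    alone. *)
Definition arc_var (B : finType) (b0 : B) u v : B + arc_type :=
  if insub (u, v) is Some a then inr a else inl b0.

Definition valuation (B : finType) R (f : B -> R) (g : V -> V -> R)
    (i : B + arc_type) : R :=
  match i with inl b => f b | inr a => g (val a).1 (val a).2 end.

Lemma valuation_arc (B : finType) (b0 : B) R (f : B -> R) g u v :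
  adj G u v -> valuation f g (arc_var b0 u v) = g u v.
Proof. by move=> uv; rewrite /arc_var insubT. Qed.

(** Common soundness criterion for both formulations: local degree conditions fix the source and the
    sink, and the labelling excludes cycles. *)
Lemma st_orientation_rank s t d (h : V -> nat) :
  orientation G d -> (forall u v, d u v -> h u < h v) ->
  (forall v, v != s -> exists u, d u v) ->
  (forall v, v != t -> exists u, d v u) ->
  (forall u, ~~ d u s) -> (forall u, ~~ d t u) ->
  st_orientation G s t d.
Proof.
move=> d_or h_mono in_s in_t out_s out_t; split=> //.
- exact: rank_acyclic h_mono.
- move=> v; have [->|/in_s[u d_uv]] := eqVneq; first by apply/forallP.
  by apply/negP => /forallP/(_ u); rewrite d_uv.
move=> v; have [->|/in_t[u d_vu]] := eqVneq; first by apply/forallP.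
by apply/negP => /forallP/(_ u); rewrite d_vu.
Qed.

End Arcs.

Lemma all_image (T : finType) (R : Type) (A : {pred T}) (f : T -> R) (a : pred R) :
  all a [seq f x | x in A] = [forall x in A, a (f x)].
Proof.
rewrite all_map; apply/allP/forall_inP => H x; first by move=> Ax; apply: H; rewrite mem_enum.
by rewrite mem_enum => /H.
Qed.

Lemma encodes_ex (V : finType) X (reads : X -> rel V -> Prop) (sol : X -> Prop) S :
  encodes reads sol S -> (exists x, sol x) <-> (exists d, S d).
Proof.
by move=> [sd ds]; split=> [[x /sd[d]]|[d /ds[x]]]; [exists d | exists x].
Qed.

(** * Integer programs given by sparse linear forms *)

Section SparseIlp.
Variable I : finType.

Definition lin := seq (int * I).

Definition lin_eval (l : lin) (xi : I -> int) : int :=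
  (\sum_(p <- l) p.1 * xi p.2)%R.

(** A variable may occur several times in a form; its coefficients add up. *)
Definition lin_coef (l : lin) (i : I) : int := (\sum_(p <- l | p.2 == i) p.1)%R.

Definition ilp_of (cs : seq (lin * int)) (obj : lin) : ilp :=
  ILP (\matrix_(r < size cs, j < #|I|) lin_coef (nth ([::], 0%R) cs r).1 (enum_val j))%R
      (\col_(r < size cs) (nth ([::], 0%R) cs r).2)%R
      (\row_(j < #|I|) lin_coef obj (enum_val j))%R.

Definition solves (cs : seq (lin * int)) (xi : I -> int) : bool :=
  all (fun c => lin_eval c.1 xi <= c.2)%R cs.

Lemma lin_coefE l (xi : 'I_#|I| -> int) :
  (\sum_j lin_coef l (enum_val j) * xi j)%R = lin_eval l (xi \o enum_rank).
Proof.
rewrite (reindex_onto enum_rank enum_val) => /=; last by move=> i _; rewrite enum_valK.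
under eq_big => [i|i _] do [rewrite enum_rankK eqxx | rewrite enum_rankK mulr_suml].
rewrite (exchange_big_dep predT) //=; apply: eq_bigr => p _.
by rewrite (big_pred1 p.2) // => i; rewrite /= eq_sym.
Qed.

Lemma ilp_of_feasible cs obj (x : 'cV_#|I|) :
  ilp_feasible (ilp_of cs obj) x <-> solves cs (fun i => x (enum_rank i) ord0).
Proof.
have E r : ((ilp_mx (ilp_of cs obj) *m x) r ord0)%R
   = lin_eval (nth ([::], 0%R) cs r).1 (fun i => x (enum_rank i) ord0).
  rewrite -(lin_coefE _ (fun j => x j ord0)) mxE.
  by apply: eq_bigr => j _; rewrite mxE.
split=> [Hx|/all_nthP Hx r].
  by apply/(all_nthP ([::], 0%R)) => r lt_r; have := Hx (Ordinal lt_r); rewrite E mxE.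
by rewrite E mxE; apply: Hx.
Qed.

Lemma ilp_of_value cs obj (x : 'cV_#|I|) :
  ilp_value (ilp_of cs obj) x = lin_eval obj (fun i => x (enum_rank i) ord0).
Proof.
rewrite -(lin_coefE _ (fun j => x j ord0)) /ilp_value mxE.
by apply: eq_bigr => j _; rewrite mxE.
Qed.

End SparseIlp.

(** * The integer program with heights bounded by [K] *)

Section StIlp.
Variables (V : finType) (G : sgraph V) (s t : V) (K : nat).

Let I : finType := (V + arc_type G)%type.
Let X (v : V) : I := inl v.
Let Y (u v : V) : I := arc_var G s u v.

Definition st_constraints : seq (lin I * int) :=
  [seq ([:: (-1, X v)], 0)%R | v : V] ++
  [seq ([:: (1%R, X v)], Posz K) | v : V] ++
  [seq ([seq (-1, Y u v) | u in adj G v], -1)%R | v in predC1 s] ++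
  [seq ([seq (-1, Y v u) | u in adj G v], -1)%R | v in predC1 t] ++
  [seq ([:: (1, Y u s)], 0)%R | u in adj G s] ++
  [seq ([:: (1, Y t u)], 0)%R | u in adj G t] ++
  [seq ([:: (-1, Y p.1 p.2)], 0)%R | p in arcs G] ++
  [seq ([:: (1, Y p.1 p.2); (1, Y p.2 p.1)], 1)%R | p in arcs G] ++
  [seq ([:: (-1, Y p.1 p.2); (-1, Y p.2 p.1)], -1)%R | p in arcs G] ++
  (* The height increases along [p] if [p] is chosen; otherwise the constraint
     is implied by the bounds [0] and [K] on heights. *)
  [seq ([:: (1%R, X p.1); ((-1)%R, X p.2); (Posz K.+1, Y p.1 p.2)], Posz K)
      | p in arcs G].

Definition st_ilp : ilp := ilp_of st_constraints [:: (1%R, X t)].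

Definition st_ilp_arc u v : 'I_(ilp_nvars st_ilp) := enum_rank (Y u v).

Lemma st_ilp_nvars : ilp_nvars st_ilp <= #|V| + 2 * #|edges G|.
Proof. by rewrite /= card_sum card_arc_type leq_add2l card_arcs. Qed.

(** Six families have at most one constraint per vertex and four have one per arc, which gives at
    most [6n + 8m]. *)
Lemma st_ilp_ncons : ilp_ncons st_ilp <= 8 * (#|V| + #|edges G|).
Proof.
rewrite /= !size_cat !size_image.
move: (card_arcs G) (max_card (predC1 s)) (max_card (predC1 t)).
move: (max_card (adj G s)) (max_card (adj G t)).
move: #|V| #|edges G| #|arcs G| #|predC1 s| #|predC1 t| #|adj G s| #|adj G t|.
lia.
Qed.

Definition st_solution (xi : I -> int) : Prop :=
  [/\ forall v, (0 <= xi (X v) <= Posz K)%R,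
      (forall v, v != s -> (1 <= \sum_(u in adj G v) xi (Y u v))%R) /\
      (forall v, v != t -> (1 <= \sum_(u in adj G v) xi (Y v u))%R),
      (forall u, adj G s u -> (xi (Y u s) <= 0)%R) /\
      (forall u, adj G t u -> (xi (Y t u) <= 0)%R),
      forall u v, adj G u v ->
        (0 <= xi (Y u v))%R /\ (xi (Y u v) + xi (Y v u) = 1)%R
    & forall u v, adj G u v ->
        (xi (X u) - xi (X v) + Posz K.+1 * xi (Y u v) <= Posz K)%R].

Lemma st_constraintsP xi : solves st_constraints xi <-> st_solution xi.
Proof.
(* The lower bound 1 on a sum is stored with both sides negated, to fit the [<=] form. *)
have sumN (A : pred V) (y : V -> I) :
    (lin_eval [seq (-1, y u) | u in A]%R xi <= -1)%R = (1 <= \sum_(u in A) xi (y u))%R.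
  rewrite /lin_eval big_image /= -[RHS]lerN2 -sumrN.
  by under eq_bigr do rewrite mulN1r.
have arcsP (P : V * V -> bool) :
    (forall p, p \in arcs G -> P p) <-> (forall u v, adj G u v -> P (u, v)).
  split=> H; first by move=> u v uv; apply: H; rewrite inE.
  by case=> u v; rewrite inE; apply: H.
have evalE p l : lin_eval (p :: l) xi = (p.1 * xi p.2 + lin_eval l xi)%R.
  exact: big_cons.
have eval0 : lin_eval [::] xi = 0%R by exact: big_nil.
rewrite /solves /st_constraints !all_cat !all_image.
split.
  case/andP=> /forall_inP X0 /andP[/forall_inP XK] /andP[/forall_inP in_s].
  case/andP=> /forall_inP in_t /andP[/forall_inP out_s] /andP[/forall_inP out_t].
  case/andP=> /forall_inP/arcsP Y0 /andP[/forall_inP/arcsP Y1].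
  case/andP=> /forall_inP/arcsP Y2 /forall_inP/arcsP XY.
  split.
  - by move=> v; move: (X0 v isT) (XK v isT); rewrite /= !evalE eval0 /=; lia.
  - by split=> v v_end; rewrite -sumN; [apply: in_s | apply: in_t].
  - by split=> u uv; [move: (out_s u uv) | move: (out_t u uv)];
      rewrite /= !evalE eval0 /=; lia.
  - move=> u v uv; move: (Y0 u v uv) (Y1 u v uv) (Y2 u v uv).
    by rewrite /= !evalE eval0 /=; lia.
  by move=> u v uv; move: (XY u v uv); rewrite /= !evalE eval0 /=; lia.
case=> X0K [in_s in_t] [out_s out_t] Y01 XY.
do ?[apply/andP; split]; apply/forall_inP => /= v; rewrite ?inE => vP;
  rewrite ?sumN ?evalE ?eval0 /=.
- by have := X0K v; lia.
- by have := X0K v; lia.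
- exact: in_s.
- exact: in_t.
- by have := out_s v vP; lia.
- by have := out_t v vP; lia.
- by have := Y01 v.1 v.2 vP; lia.
- by have := Y01 v.1 v.2 vP; lia.
- by have := Y01 v.1 v.2 vP; lia.
by have := XY v.1 v.2 vP; lia.
Qed.

(** Nonnegative integers with sum 1 are 0 and 1, so the arc variables define an orientation. The
    heights increase along it, hence bound all paths by [K] and those from [s] to [t] by the height
    of [t]. *)
Lemma st_solution_sound xi : st_solution xi ->
  exists d : rel V, [/\ st_orientation G s t d,
      forall u v, adj G u v -> xi (Y u v) = Posz (d u v),
      longest_path d <= K
    & (Posz (longest_path_between s t d) <= xi (X t))%R].
Proof.
case=> X0K [in_s in_t] [out_s out_t] Y01 XY.
pose d u v := adj G u v && (xi (Y u v) == 1%R).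
have xiY u v : adj G u v -> xi (Y u v) = Posz (d u v).
  move=> uv; rewrite /d uv /=; have vu : adj G v u by rewrite adj_sym.
  by have := Y01 u v uv; have := Y01 v u vu; case: eqP; lia.
pose h v := `|xi (X v)|%N.
(* For a chosen arc the coefficient [K.+1] exceeds the right-hand side [K] by one, which is the
   strict increase. *)
have h_mono u v : d u v -> h u < h v.
  case/andP=> uv /eqP y1; have := XY u v uv; rewrite y1 /h.
  by have := X0K u; have := X0K v; lia.
(* A sum of zeros and ones that is at least 1 has a term equal to 1. *)
have sum_ex (A : pred V) (f : V -> bool) (y : V -> int) :
    (forall u, u \in A -> y u = Posz (f u)) -> (1 <= \sum_(u in A) y u)%R ->
    exists u, f u.
  move=> yf; case: (pickP f) => [u fu|f0]; first by exists u.
  by rewrite big1 // => u /yf ->; rewrite f0.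
exists d; split=> //.
- apply: (st_orientation_rank _ h_mono).
  + split=> u v; first by case/andP.
    move=> uv; have vu : adj G v u by rewrite adj_sym.
    by have [_] := Y01 u v uv; rewrite !xiY //; case: (d u v) (d v u) => [] [].
  + move=> v /in_s; apply: sum_ex => u uv; apply: xiY; by rewrite adj_sym.
  + by move=> v /in_t; apply: sum_ex => u uv; apply: xiY.
  + move=> u; apply/negP => /[dup] /andP[us _].
    by have := out_s u; rewrite adj_sym us xiY // => /(_ isT); case: (d u s).
  + move=> u; apply/negP => /[dup] /andP[tu _].
    by have := out_t u tu; rewrite xiY //; case: (d t u).
- by apply: (rank_longest_path h_mono) => v; rewrite /h; have := X0K v; lia.
by have := rank_longest_path_between h_mono s t; rewrite /h; have := X0K t; lia.
Qed.

(** Longest-path heights satisfy all constraints, and at [t] they attain the lower bound that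
    soundness puts on the objective. *)
Lemma st_solution_complete d :
  st_orientation G s t d -> (forall v, height d v <= K) ->
  exists xi, [/\ st_solution xi,
      forall u v, adj G u v -> xi (Y u v) = Posz (d u v)
    & xi (X t) = Posz (longest_path_between s t d)].
Proof.
case=> -[d_adj d_or] d_acyc src snk hK.
pose xi : I -> int :=
  valuation (fun v => Posz (height d v)) (fun u v => Posz (d u v)).
have xiY u v : adj G u v -> xi (Y u v) = Posz (d u v) by exact: valuation_arc.
have sum_ge1 (A : pred V) (y : V -> int) u : (forall w, w \in A -> 0 <= y w)%R ->
    u \in A -> y u = 1%R -> (1 <= \sum_(w in A) y w)%R.
  move=> y0 Au yu; rewrite (bigD1 u) //= yu lerDl.
  by apply: sumr_ge0 => w /andP[/y0].
exists xi; split=> //; last by rewrite -height_longest_between.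
split.
- by move=> v; rewrite /= lez_nat hK.
- split=> v.
    rewrite -src negb_forall => /existsP[u]; rewrite negbK => d_uv.
    have uv := d_adj _ _ d_uv.
    apply: (sum_ge1 _ _ u) => [w wv||]; last by rewrite xiY ?d_uv.
      by rewrite xiY // adj_sym.
    by rewrite -[_ \in _]/(adj G v u) adj_sym.
  rewrite -snk negb_forall => /existsP[u]; rewrite negbK => d_vu.
  have vu := d_adj _ _ d_vu.
  by apply: (sum_ge1 _ _ u) => [w wv||]; rewrite ?xiY ?d_vu.
- split=> u uv.
    rewrite xiY 1?adj_sym //.
    by have := src s; rewrite eqxx => /forallP/(_ u)/negPf ->.
  by rewrite xiY //; have := snk t; rewrite eqxx => /forallP/(_ u)/negPf ->.
- move=> u v uv; rewrite (xiY u) // (xiY v) 1?adj_sym //; split=> //.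
  by have := d_or u v uv; case: (d u v) (d v u) => [] [].
(* An arc that is not chosen only needs [height d u <= K]; a chosen one needs the strict
   increase. *)
move=> u v uv; rewrite xiY //=; have := hK u; case d_uv: (d u v); last by lia.
by have := height_arc d_acyc d_uv; lia.
Qed.

Lemma st_ilp_sound x : ilp_feasible st_ilp x ->
  exists d, [/\ st_orientation G s t d, ilp_reads G st_ilp_arc x d,
      longest_path d <= K
    & (Posz (longest_path_between s t d) <= ilp_value st_ilp x)%R].
Proof.
move=> /ilp_of_feasible/st_constraintsP/st_solution_sound[d [st_d xd dK td]].
by exists d; split=> //; rewrite ilp_of_value /lin_eval big_seq1 mul1r.
Qed.

Lemma st_ilp_complete d :
  st_orientation G s t d -> (forall v, height d v <= K) ->
  exists x, [/\ ilp_feasible st_ilp x, ilp_reads G st_ilp_arc x d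
    & ilp_value st_ilp x = Posz (longest_path_between s t d)].
Proof.
move=> st_d hK; have [xi [xi_sol xd xt]] := st_solution_complete st_d hK.
pose x : 'cV_#|I| := (\col_j xi (enum_val j))%R.
have xE i : x (enum_rank i) ord0 = xi i by rewrite mxE enum_rankK.
exists x; split.
- apply/ilp_of_feasible; rewrite /solves (eq_all (a2 := fun c => lin_eval c.1 xi <= c.2)%R).
    exact/st_constraintsP.
  by move=> c; rewrite /lin_eval; under eq_bigr do rewrite xE.
- by move=> u v uv; rewrite xE xd.
by rewrite ilp_of_value /lin_eval big_seq1 mul1r xE.
Qed.

End StIlp.

(** * Clauses over an arbitrary finite type of variables *)

Section CnfOver.
Variable J : finType.

Definition sat_of (cs : seq (seq (J * bool))) : sat :=
  SAT [seq [seq (enum_rank l.1, l.2) | l <- c] | c <- cs].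

Definition models (cs : seq (seq (J * bool))) (al : J -> bool) : bool :=
  all (has (fun l => al l.1 == l.2)) cs.

Lemma sat_of_satisfies cs (a : {ffun 'I_#|J| -> bool}) :
  satisfies (sat_of cs) a = models cs (fun j => a (enum_rank j)).
Proof. by rewrite /satisfies all_map; apply: eq_all => c /=; rewrite has_map. Qed.

End CnfOver.

(** * The SAT formulation with unary heights *)

Section StSat.
Variables (V : finType) (G : sgraph V) (s t : V) (k' : nat).
(** Positivity provides [ord0 : 'I_k], used in the default of [arc_var] and in the clauses stating
    that a height is positive. *)
Let k := k'.+1.

(* [X v i] states that the height of [v] exceeds [i]. *)
Let J : finType := (V * 'I_k + arc_type G)%type.
Let X (v : V) (i : 'I_k) : J := inl (v, i).
Let Y (u v : V) : J := arc_var G (s, ord0 : 'I_k) u v.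

Definition inner_arcs : {set V * V} := [set p in arcs G | (p.1 != s) && (p.2 != s)].

(** On an arc from [u] to [v], a height of [u] above [i] forces one of [v] above [i.+1]. For the
    last index the positive literal is missing, and the clause forbids the tail of an arc to have
    height [k]. *)
Definition increase_clause (u v : V) (i : 'I_k) : seq (J * bool) :=
  [:: (Y u v, false), (X u i, false) &
      if insub i.+1 is Some j then [:: (X v j, true)] else [::]].

(* Clauses of size 3 are not allowed when [#|V| = 2]; they are only needed on
   arcs avoiding [s], since unit clauses give [s] height 0 and all other
   vertices a positive height. *)
Definition st_clauses : seq (seq (J * bool)) :=
  [seq [seq (Y u v, true) | u in adj G v] | v in predC1 s] ++
  [seq [seq (Y v u, true) | u in adj G v] | v in predC1 t] ++
  [seq [:: (Y u s, false)] | u in adj G s] ++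
  [seq [:: (Y t u, false)] | u in adj G t] ++
  [seq [:: (Y p.1 p.2, true); (Y p.2 p.1, true)] | p in arcs G] ++
  [seq [:: (Y p.1 p.2, false); (Y p.2 p.1, false)] | p in arcs G] ++
  [seq [:: (X s i, false)] | i : 'I_k] ++
  [seq [:: (X v ord0, true)] | v in predC1 s] ++
  [seq increase_clause q.1.1 q.1.2 q.2 | q in setX inner_arcs setT].

Definition st_sat : sat := sat_of st_clauses.

Definition st_sat_arc u v : 'I_(sat_nvars st_sat) := enum_rank (Y u v).

Lemma st_sat_nvars : sat_nvars st_sat <= 2 * (k * (#|V| + #|edges G|)).
Proof.
rewrite /= card_sum card_arc_type card_prod card_ord.
by move: #|V| #|edges G| #|arcs G| (card_arcs G); rewrite /k; nia.
Qed.

Lemma st_sat_size :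
  size (sat_clauses st_sat) <= 8 * (k ^ 2 * (#|V| + #|edges G|)).
Proof.
rewrite /= size_map !size_cat !size_image cardsX cardsT !card_ord.
have /subset_leq_card : inner_arcs \subset arcs G.
  by apply/subsetP => p; rewrite inE => /andP[].
(* Nonemptiness of [V] lets [k ^ 2 * #|V|] absorb the [k] unit clauses on [s]. *)
have V_gt0 : 0 < #|V| by apply/card_gt0P; exists s.
move: V_gt0 (card_arcs G) (max_card (predC1 s)) (max_card (predC1 t)).
move: (max_card (adj G s)) (max_card (adj G t)).
move: #|V| #|edges G| #|arcs G| #|predC1 s| #|predC1 t| #|adj G s| #|adj G t|.
move: #|inner_arcs|; rewrite /k => i n m a ps pt cs ct *.
have kq : k'.+1 <= k'.+1 ^ 2 by rewrite -[X in X <= _]expn1 leq_pexp2l.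
move: (k'.+1 ^ 2) kq => q kq.
have : i * k'.+1 <= 2 * m * q by apply: leq_mul => //; lia.
have : 0 < q by lia.
nia.
Qed.

(** Degree clauses have at most one literal per vertex. Clauses of size 1 or 2 fit since [s] and [t]
    are distinct, and an inner arc together with [s] supplies the three vertices needed for size
    3. *)
Lemma st_sat_clause_size : adj G s t ->
  all (fun c => size c <= #|V|) (sat_clauses st_sat).
Proof.
move=> st; have adj_neq u v : adj G u v -> u != v.
  by apply: contraTneq => ->; rewrite adj_irrefl.
have V_gt1 : 1 < #|V|.
  by have := max_card (pred_of_set [set s; t]); rewrite cards2 (adj_neq _ _ st).
rewrite /= all_map (eq_all (a2 := fun c => size c <= #|V|)); last first.
  by move=> c; rewrite /= size_map.
rewrite !all_cat !all_image.
do ?[apply/andP; split]; apply/forall_inP => /= v vP;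
  rewrite ?size_image ?max_card //; do ?exact: ltnW.
move: vP; case: v => -[u v] i; rewrite !inE /= andbT => /and3P[uv u_s v_s].
have /card_uniqP /= E : uniq [:: s; u; v].
  by rewrite /= !inE negb_or eq_sym u_s eq_sym v_s (adj_neq _ _ uv).
apply: (@leq_trans #|[:: s; u; v]|); last exact: max_card.
by rewrite E; case: insubP.
Qed.

Definition sat_solution (al : J -> bool) : Prop :=
  [/\ (forall v, v != s -> exists2 u, adj G v u & al (Y u v)) /\
      (forall v, v != t -> exists2 u, adj G v u & al (Y v u)),
      (forall u, adj G s u -> ~~ al (Y u s)) /\
      (forall u, adj G t u -> ~~ al (Y t u)),
      forall u v, adj G u v -> al (Y u v) (+) al (Y v u),
      (forall i, ~~ al (X s i)) /\ (forall v, v != s -> al (X v ord0))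
    & forall u v, adj G u v -> u != s -> v != s -> al (Y u v) ->
      forall i, al (X u i) -> exists2 j : 'I_k, j = i.+1 :> nat & al (X v j)].

Lemma st_clausesP al : models st_clauses al <-> sat_solution al.
Proof.
have hasP_image (A : pred V) (y : V -> J) :
    reflect (exists2 u, u \in A & al (y u))
            (has (fun l => al l.1 == l.2) [seq (y u, true) | u in A]).
  rewrite has_map; apply: (iffP hasP) => -[u Au yu]; exists u => //.
  - by rewrite mem_enum in Au.
  - by move: yu => /=; case: (al _).
  - by rewrite mem_enum.
  by rewrite /= yu.
have arcsP (P : V * V -> bool) :
    (forall p, p \in arcs G -> P p) <-> (forall u v, adj G u v -> P (u, v)).
  split=> H; first by move=> u v uv; apply: H; rewrite inE.
  by case=> u v; rewrite inE; apply: H.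
have incP u v (i : 'I_k) : has (fun l => al l.1 == l.2) (increase_clause u v i) <->
    (al (Y u v) -> al (X u i) -> exists2 j : 'I_k, j = i.+1 :> nat & al (X v j)).
  rewrite /increase_clause /=; case: insubP => [j _ ji|i_k] /=.
    rewrite orbF; split=> [H yuv xui|H].
      by exists j => //; move: H; rewrite yuv xui /=; case: (al _).
    case: (al (Y u v)) (al (X u i)) H => [] [] //= /(_ isT isT)[j' j'i].
    by have <- : j' = j by [apply: val_inj; rewrite /= j'i ji]; move=> ->.
  rewrite orbF; split=> [H yuv xui|H]; first by move: H; rewrite yuv xui.
  case: (al (Y u v)) (al (X u i)) H => [] [] //= /(_ isT isT)[j' j'i].
  by rewrite -j'i ltn_ord in i_k.
rewrite /models /st_clauses !all_cat !all_image.
split.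
  case/andP=> /forall_inP in_s /andP[/forall_inP in_t] /andP[/forall_inP out_s].
  case/andP=> /forall_inP out_t /andP[/forall_inP/arcsP Y1 /andP[/forall_inP/arcsP Y2]].
  case/andP=> /forall_inP Xs /andP[/forall_inP X0 /forall_inP XY].
  split.
  - split=> v v_end; first exact/(hasP_image (adj G v) (fun u => Y u v))/in_s.
    exact/(hasP_image (adj G v) (Y v))/in_t.
  - by split=> u uP; [have := out_s u uP | have := out_t u uP]; rewrite /= orbF => /eqP ->.
  - by move=> u v uv; have := Y1 u v uv; have := Y2 u v uv; rewrite /=;
      case: (al (Y u v)) (al (Y v u)) => [] [].
  - split; first by move=> i; have := Xs i isT; rewrite /= orbF => /eqP ->.
    by move=> v v_s; have := X0 v v_s; rewrite /= orbF => /eqP ->.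
  move=> u v uv u_s v_s yuv i; apply: (incP u v i).1 yuv; apply: (XY (u, v, i)).
  by rewrite !inE /= uv u_s v_s.
case=> -[in_s in_t] [out_s out_t] Y1 [Xs X0] XY.
do ?[apply/andP; split]; apply/forall_inP => /= v vP.
- exact/hasP_image/in_s.
- exact/hasP_image/in_t.
- by rewrite (negPf (out_s v vP)).
- by rewrite (negPf (out_t v vP)).
- by rewrite inE in vP; have := Y1 _ _ vP; case: (al _) (al _) => [] [].
- by rewrite inE in vP; have := Y1 _ _ vP; case: (al _) (al _) => [] [].
- by rewrite (negPf (Xs v)).
- by rewrite X0.
move: vP; rewrite !inE andbT => /and3P[uv u_s v_s].
by apply/incP => yuv; apply: XY.
Qed.

(** The true values of [X v] may fail to form an initial segment, so the height of [v] is read as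
    the largest [i.+1] with [X v i] true. *)
Lemma sat_solution_sound al : sat_solution al ->
  exists2 d : rel V, height_st_orientation G k s t d &
      forall u v, adj G u v -> al (Y u v) = d u v.
Proof.
case=> -[in_s in_t] [out_s out_t] Y1 [Xs X0] XY.
pose d u v := adj G u v && al (Y u v).
have dE u v : adj G u v -> al (Y u v) = d u v by rewrite /d => ->.
pose h v := \max_(i < k | al (X v i)) i.+1.
have h_s : h s = 0 by rewrite /h big_pred0 // => i; apply/negbTE.
have h_gt v i : al (X v i) -> i < h v.
  by move=> Xvi; apply: (@leq_bigmax_cond _ (fun i => al (X v i)) (fun i : 'I_k => i.+1)).
have out_s' u : ~~ d u s.
  by apply/negP => /andP[us]; apply/negP/out_s; rewrite adj_sym.
have h_mono u v : d u v -> h u < h v.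
  (* No arc enters [s], so the head has positive height. This settles arcs leaving [s]; on the
     others the increase clauses bound [h u] by the predecessor of [h v]. *)
  move=> d_uv; have v_s : v != s.
    by apply/eqP => vs; move: d_uv; rewrite vs (negPf (out_s' u)).
  have hv_gt0 := h_gt v ord0 (X0 v v_s).
  have [->|u_s] := eqVneq u s; first by rewrite h_s.
  case/andP: d_uv => uv yuv; rewrite -(prednK hv_gt0) ltnS.
  apply/bigmax_leqP => i Xui; rewrite -ltnS (prednK hv_gt0).
  by have [j <- /h_gt] := XY u v uv u_s v_s yuv i Xui.
exists d => //; split.
  apply: (st_orientation_rank _ h_mono) => //.
  - split=> u v; first by case/andP.
    by move=> uv; have := Y1 u v uv; rewrite !dE // adj_sym.
  - by move=> v /in_s[u vu yuv]; exists u; rewrite /d adj_sym vu.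
  - by move=> v /in_t[u vu yvu]; exists u; rewrite /d vu.
  by move=> u; apply/negP => /andP[tu]; apply/negP/out_t.
by apply: (rank_longest_path h_mono) => v; apply/bigmax_leqP.
Qed.

Lemma sat_solution_complete d : height_st_orientation G k s t d ->
  exists2 al, sat_solution al & forall u v, adj G u v -> al (Y u v) = d u v.
Proof.
case=> -[[d_adj d_or] d_acyc src snk] dk.
have hk v : height d v <= k := leq_trans (height_le_longest d v) dk.
pose al : J -> bool := valuation (fun q : V * 'I_k => q.2 < height d q.1) d.
have alY u v : adj G u v -> al (Y u v) = d u v by exact: valuation_arc.
have dY u v : d u v -> al (Y u v) by move=> /[dup] /d_adj/alY ->.
have in_s v : v != s -> exists u, d u v.
  by rewrite -src negb_forall => /existsP[u]; rewrite negbK; exists u.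
have in_t v : v != t -> exists u, d v u.
  by rewrite -snk negb_forall => /existsP[u]; rewrite negbK; exists u.
exists al => //; split.
- split=> v; first by move=> /in_s[u uv]; exists u; rewrite ?dY // adj_sym d_adj.
  by move=> /in_t[u vu]; exists u; rewrite ?dY // d_adj.
- split=> u; first rewrite adj_sym => us; last move=> tu; rewrite alY //.
    by have := src s; rewrite eqxx => /forallP.
  by have := snk t; rewrite eqxx => /forallP.
- by move=> u v uv; rewrite (alY u) // (alY v) ?d_or // adj_sym.
- split; first by move=> i; rewrite /= height_source // src.
  by move=> v /in_s[u /(height_arc d_acyc)] /=; lia.
move=> u v uv _ _; rewrite alY // => /(height_arc d_acyc) lt_h i /= lt_i.
(* From [i < height d u < height d v <= k], the index [i.+1] is still in range. *)
have lt_k : i.+1 < k by have := hk v; lia.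
by exists (Ordinal lt_k) => //=; lia.
Qed.

Lemma st_sat_encodes :
  encodes (sat_reads G st_sat_arc) (satisfies st_sat) (height_st_orientation G k s t).
Proof.
split=> [a|d /sat_solution_complete[al /st_clausesP al_sol al_d]].
  rewrite sat_of_satisfies => /st_clausesP/sat_solution_sound[d st_d ad].
  by exists d.
exists [ffun j => al (enum_val j)]; last by move=> u v uv; rewrite ffunE enum_rankK al_d.
rewrite sat_of_satisfies; move: al_sol; congr is_true; apply: eq_all => c.
by apply: eq_has => l /=; rewrite ffunE enum_rankK.
Qed.

End StSat.

(** * Assembly of the three formulations *)

Theorem theorem3 :
  exists C : nat,
  forall (V : finType) (G : sgraph V) (s t : V), adj G s t ->
  let n := #|V| in
  let m := #|edges G| in
  (* (a) *)
  (exists (P : ilp) (arc : V -> V -> 'I_(ilp_nvars P)),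
     [/\ ilp_nvars P <= C * (n * (n + m)),
         ilp_ncons P <= C * (n * (n + m)),
         encodes (ilp_reads G arc) (ilp_feasible P) (st_orientation G s t)
       & encodes (ilp_reads G arc) (ilp_optimal P)
                 (optimum_st_orientation G s t)]) /\
  (* (b) *)
  (forall k : nat, 0 < k ->
   exists (P : ilp) (arc : V -> V -> 'I_(ilp_nvars P)),
     [/\ ilp_nvars P <= C * (k * (n + m)),
         ilp_ncons P <= C * (k * (n + m)),
         (exists x, ilp_feasible P x) <->
           (exists d, height_st_orientation G k s t d)
       & encodes (ilp_reads G arc) (ilp_feasible P)
                 (height_st_orientation G k s t)]) /\
  (* (c) *)
  (forall k : nat, 0 < k ->
   exists (F : sat) (arc : V -> V -> 'I_(sat_nvars F)),
     [/\ sat_nvars F <= C * (k * (n + m)),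
         size (sat_clauses F) <= C * (k ^ 2 * (n + m)),
         all (fun c => size c <= n) (sat_clauses F),
         (exists a, satisfies F a) <->
           (exists d, height_st_orientation G k s t d)
       & encodes (sat_reads G arc) (satisfies F)
                 (height_st_orientation G k s t)]).
Proof.
exists 8 => V G s t st n m.
have V_gt0 : 0 < #|V| by apply/card_gt0P; exists s.
have nvars k l : 0 < l -> ilp_nvars (st_ilp G s t k) <= 8 * (l * (n + m)).
  by have := st_ilp_nvars G s t k; rewrite -/n -/m; nia.
have ncons k l : 0 < l -> ilp_ncons (st_ilp G s t k) <= 8 * (l * (n + m)).
  by have := st_ilp_ncons G s t k; rewrite -/n -/m; nia.
(* Simple paths have fewer than [n] arcs, so with [K] equal to [n] the height bound excludes no
   orientation. *)
have complete d : st_orientation G s t d -> _ :=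
  fun st_d => st_ilp_complete st_d (fun v => ltnW (height_ltn d v)).
split; [|split].
- exists (st_ilp G s t n), (st_ilp_arc G s t n); split; [exact: nvars | exact: ncons | |].
    split=> [x /st_ilp_sound[d [st_d xd _ _]]|d /complete[x [x_sol xd _]]].
      by exists d.
    by exists x.
  (* A feasible value is at least the longest path length of the orientation read off, and every
     orientation has a solution attaining equality; hence both minimisations agree. *)
  split=> [x [/st_ilp_sound[d [st_d xd _ dx]] x_min]|d [/complete[x [x_sol xd ex]] d_min]].
    exists d => //; split=> // d' /complete[x' [/x_min le_x _ ex']].
    by rewrite -lez_nat -ex'; apply: le_trans le_x.
  exists x => //; split=> // y /st_ilp_sound[d' [/d_min le_d _ _]].
  by rewrite ex; apply: le_trans; rewrite lez_nat.
- move=> k k_gt0; exists (st_ilp G s t k), (st_ilp_arc G s t k).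
  have enc : encodes (ilp_reads G (st_ilp_arc G s t k))
      (ilp_feasible (st_ilp G s t k)) (height_st_orientation G k s t).
    split=> [x /st_ilp_sound[d [st_d xd dk _]]|d [st_d dk]]; first by exists d.
    have hk v : height d v <= k := leq_trans (height_le_longest d v) dk.
    by have [x [x_sol xd _]] := st_ilp_complete st_d hk; exists x.
  by split; [exact: nvars | exact: ncons | exact: encodes_ex enc | ].
(* From here [k] is the predecessor of the height bound, as [st_sat] expects. *)
case=> // k _; exists (st_sat G s t k), (st_sat_arc G s t k).
have enc := st_sat_encodes G s t k.
split; [| exact: st_sat_size | exact: st_sat_clause_size | exact: encodes_ex enc | exact: enc].
by have := st_sat_nvars G s t k; rewrite -/n -/m; lia.
Qed.
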